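(* Let $K$ be a nonnegative integer. The stationary mean number $\mathbb E(N_K)$ of customers in the symmetric join-the-shortest-queue system with two queues of capacity $K$ can be bounded as follows. For $\rho>0$, $\rho\ne1$, $$\frac{2\rho\left(1-\left(1+2K(1-\rho)\right)\rho^{2K}\right)}{(1-\rho)\left(1+\rho-2\rho^{2K+1}\right)}\le\mathbb E(N_K)\le\left(2K(\rho-1)+\rho^{-2K}-1\right)\frac{\rho\,\pi_K(K,K)}{(\rho-1)^2},$$ where $$\pi_K(K,K)=\frac{2\rho^{2K}}{2\sum_{k=0}^{2K}\rho^k-\sum_{k=0}^{K-1}(\rho/2)^k},$$ and for $\rho=1$, $$\frac{K(2K+1)}{2K+1/2}\le\mathbb E(N_K)\le\frac{K(2K+1)}{2K+2^{-K}}.$$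
   Context: Symmetric finite-capacity JSQ model: two one-server queues, each of capacity $K$; service times are exponential with parameter $1$ at both queues; customers arrive according to a Poisson process with parameter $2\rho$ and join the shortest queue, or either queue with probability $1/2$ if both lengths are equal; when both queues have length $K$ arriving customers are lost. The queue-length process $(L_1(t),L_2(t))_{t\ge0}$ is the continuous-time Markov chain on $\{0,\dots,K\}^2$ with the following transition rates ($e_1,e_2$ the unit vectors). From $(k,k)$: to $(k,k)+e_1$ and to $(k,k)+e_2$ at rate $\rho$ each if $k<K$; to $(k,k)-e_1$ and to $(k,k)-e_2$ at rate $1$ each if $k>0$. From $(j,k)$ with $j<k$: to $(j+1,k)$ at rate $2\rho$, to $(j-1,k)$ at rate $1$ if $j>0$, to $(j,k-1)$ at rate $1$. From $(k,j)$ with $j<k$: to $(k,j+1)$ at rate $2\rho$, to $(k,j-1)$ at rate $1$ if $j>0$, to $(k-1,j)$ at rate $1$. The chain is irreducible, and $\pi_K$ denotes its unique invariant probability distribution. $N_K=L_1+L_2$ where $(L_1,L_2)$ has distribution $\pi_K$. An empty sum is $0$. *)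

(* Defs.v *)
From mathcomp Require Import all_boot all_order all_algebra.
From mathcomp Require Import reals.

Set Implicit Arguments.
Unset Strict Implicit.
Unset Printing Implicit Defensive.

Import Order.TTheory GRing.Theory Num.Theory.
Local Open Scope ring_scope.

Section Chain.
Variables (R : realType) (T : finType).

(* [q x y] is the jump rate from x to y for x != y; its diagonal is unused. *)
Definition generator (q : T -> T -> R) (x y : T) : R :=
  if x == y then - \sum_(z | z != x) q x z else q x y.

Definition is_distribution (p : T -> R) : Prop :=
  (forall x, 0 <= p x) /\ \sum_x p x = 1.

(* p is a probability distribution with p Q = 0, where Q = generator q. *)
Definition invariant_distribution (q : T -> T -> R) (p : T -> R) : Prop :=
  is_distribution p /\ forall y, \sum_x p x * generator q x y = 0.

End Chain.

(* Ordinals of 'I_K.+1 are the queue lengths 0, ..., K. *)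
Definition jsq_state (K : nat) : finType := ('I_K.+1 * 'I_K.+1)%type.

(* Arrival rate, for arrivals of total rate 2 * rho, at a queue of length l
   when the other queue has length m. *)
Definition arrival_rate (R : realType) (rho : R) (l m : nat) : R :=
  if (l < m)%N then 2 * rho else if l == m then rho else 0.

(* A coordinate cannot reach K + 1 or go below 0 inside [jsq_state K], so
   arrivals at (K, K) are lost and there is no departure from an empty queue;
   a queue of length K other than in state (K, K) receives no arrival since it
   is the longer one. *)
Definition jsq_rate (R : realType) (K : nat) (rho : R)
    (x y : jsq_state K) : R :=
  let: (l1, l2) := (x.1 : nat, x.2 : nat) in
  let: (m1, m2) := (y.1 : nat, y.2 : nat) in
  if (m1 == l1.+1) && (m2 == l2) then arrival_rate rho l1 l2
  else if (m1 == l1) && (m2 == l2.+1) then arrival_rate rho l2 l1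
  else if (m1.+1 == l1) && (m2 == l2) then 1
  else if (m1 == l1) && (m2.+1 == l2) then 1
  else 0.

(* The expectation of L1 + L2 when (L1, L2) has distribution p. *)
Definition mean_customers (R : realType) (K : nat) (p : jsq_state K -> R) : R :=
  \sum_x p x * ((x.1 : nat) + (x.2 : nat))%:R.

Definition full_state (K : nat) : jsq_state K := (ord_max, ord_max).

(* Main.v *)
(** Let a_n be the stationary probability of N = n. Cutting between levels n
    and n + 1 gives 2 rho a_n = 2 a_(n+1) - P(N = n + 1, one queue is empty),
    hence rho a_n <= a_(n+1) and a_1 = 2 rho a_0. Descending from
    a_(2K) = p(K, K) bounds a_n by p(K, K) rho^(n - 2K), which is the upper
    bound on the mean; ascending shows that N dominates, in likelihood-ratio
    order, the law proportional to (1, 2 rho, 2 rho^2, ..., 2 rho^(2K)), whose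
    mean is the lower bound. The blocking probability comes from an explicit
    function on which the generator is constant except at (K, K). *)

Require Import Defs.
From mathcomp Require Import all_boot all_order all_algebra.
From mathcomp Require Import reals zify ring lra.

Import Order.TTheory GRing.Theory Num.Theory.
Local Open Scope ring_scope.

(** * Invariance as vanishing mean drift of test functions *)

(** Rows of the generator $Q$ sum to zero, so the inner sum is $(Qf)(x)$ and the whole is $pQf$. *)
Lemma invariant_drift (R : realType) (T : finType) (q : T -> T -> R)
    (p f : T -> R) : invariant_distribution q p ->
  \sum_x p x * (\sum_y q x y * (f y - f x)) = 0.
Proof.
move=> [_ pQ0].
have gen x : \sum_y q x y * (f y - f x) = \sum_y generator q x y * f y.
  rewrite (bigD1 x) //= subrr mulr0 add0r [RHS](bigD1 x) //= /generator eqxx.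
  rewrite mulNr mulr_suml -sumrN -big_split /=.
  by apply: eq_bigr => y /negPf; rewrite eq_sym => ->; ring.
under eq_bigr do rewrite gen mulr_sumr.
rewrite exchange_big big1 //= => y _.
under eq_bigr do rewrite mulrA.
by rewrite -mulr_suml pQ0 mul0r.
Qed.

(** Lets jump targets be arbitrary pairs of naturals: one outside the square contributes 0, which is
    how arrivals at a full queue disappear. *)
Lemma sum_jsq_state1 (R : realType) (K a b : nat) (g : nat -> nat -> R) :
  \sum_(y : jsq_state K) ((val y.1 == a) && (val y.2 == b))%:R * g y.1 y.2
  = ((a <= K)%N && (b <= K)%N)%:R * g a b.
Proof.
case: (boolP (_ && _)) => [/andP[aK bK]|nab].
  rewrite (bigD1 ((inord a, inord b) : jsq_state K)) //= !inordK // !eqxx.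
  rewrite big1 ?addr0 // => -[i j] /= ne; case: eqP => [ia|]; last by rewrite mul0r.
  case: eqP => [jb|]; last by rewrite mul0r.
  by move: ne; rewrite -ia -jb !inord_val eqxx.
rewrite mul0r big1 // => -[i j] _ /=; case: eqP => [ia|]; last by rewrite mul0r.
case: eqP => [jb|]; last by rewrite mul0r.
by move: nab; rewrite -ia -jb !leq_ord.
Qed.

(* The generator applied to f, at (i, j). *)
Definition jsq_drift {R : realType} (K : nat) (rho : R) (f : nat -> nat -> R)
    (i j : nat) : R :=
  arrival_rate rho i j * (i < K)%N%:R * (f i.+1 j - f i j)
  + arrival_rate rho j i * (j < K)%N%:R * (f i j.+1 - f i j)
  + (0 < i)%N%:R * (f i.-1 j - f i j) + (0 < j)%N%:R * (f i j.-1 - f i j).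

Lemma jsq_driftE (R : realType) (K : nat) (rho : R) (f : nat -> nat -> R)
    (x : jsq_state K) :
  \sum_y jsq_rate rho x y * (f y.1 y.2 - f x.1 x.2) = jsq_drift K rho f x.1 x.2.
Proof.
case: x => i j /=; set g := fun a b => f a b - f i j.
have iK : (i <= K)%N by rewrite -ltnS.
have jK : (j <= K)%N by rewrite -ltnS.
transitivity (\sum_(y : jsq_state K)
  (arrival_rate rho i j * (((val y.1 == i.+1) && (val y.2 == j))%:R * g y.1 y.2)
   + arrival_rate rho j i * (((val y.1 == i) && (val y.2 == j.+1))%:R * g y.1 y.2)
   + (0 < i)%N%:R * (((val y.1 == i.-1) && (val y.2 == j))%:R * g y.1 y.2)
   + (0 < j)%N%:R * (((val y.1 == i) && (val y.2 == j.-1))%:R * g y.1 y.2))).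
  apply: eq_bigr => -[a b] _ /=; rewrite /jsq_rate /= -/(g a b).
  move: (nat_of_ord a) (nat_of_ord b) (nat_of_ord i) (nat_of_ord j) g =>
    {iK jK} {}a {}b {}i {}j g.
  have pos (m n : nat) : (m.+1 == n) = (0 < n)%N && (m == n.-1) by case: n.
  rewrite !pos -andbA; set b1 := (a == i.+1) && _; set b2 := (a == i) && _.
  set b3 := (0 < i)%N && _; set b4 := (a == i) && (_ && _).
  have b3E : (0 < i)%N%:R * (((a == i.-1) && (b == j))%:R * g a b)
      = b3%:R * g a b by rewrite mulrA -natrM mulnb.
  have b4E : (0 < j)%N%:R * (((a == i) && (b == j.-1))%:R * g a b)
      = b4%:R * g a b by rewrite mulrA -natrM mulnb andbCA.
  rewrite b3E b4E.
  (* The four targets are pairwise distinct, so the nested conditional of [jsq_rate] equals a sum of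
     four indicators. *)
  have : (b1 + b2 + b3 + b4 <= 1)%N by rewrite /b1 /b2 /b3 /b4; clear; lia.
  by case: b1 b2 b3 b4 {b3E b4E} => [] [] [] [] //= _; ring.
rewrite !big_split /= -!mulr_sumr !sum_jsq_state1 /jsq_drift.
by rewrite !iK !jK !andbT !(leq_trans (leq_pred _)) // /= !mul1r !mulrA.
Qed.

Lemma jsq_balance (R : realType) (K : nat) (rho : R) (p : jsq_state K -> R)
    (f : nat -> nat -> R) : invariant_distribution (@jsq_rate R K rho) p ->
  \sum_x p x * jsq_drift K rho f x.1 x.2 = 0.
Proof.
move=> p_inv.
rewrite -[RHS](invariant_drift _ _ _ _ (fun x : jsq_state K => f x.1 x.2) p_inv).
by apply: eq_bigr => x _; rewrite jsq_driftE.
Qed.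

(** * The law of $N$ and the cuts between its levels *)

Definition level {R : realType} {K : nat} (p : jsq_state K -> R) (n : nat) : R :=
  \sum_x p x * (x.1 + x.2 == n :> nat)%N%:R.

Lemma sum_level (R : realType) (K : nat) (p : jsq_state K -> R) (g : nat -> R) :
  \sum_(0 <= n < (2 * K).+1) level p n * g n = \sum_x p x * g (x.1 + x.2)%N.
Proof.
under eq_bigr do rewrite /level mulr_suml.
rewrite exchange_big /=; apply: eq_bigr => -[i j] _ /=.
have ijK : (i + j < (2 * K).+1)%N by rewrite ltnS mul2n -addnn leq_add ?leq_ord.
rewrite big_mkord (bigD1 (Ordinal ijK)) //= eqxx mulr1 big1 ?addr0 // => n.
by rewrite -val_eqE eq_sym /= => /negPf ->; rewrite mulr0 mul0r.
Qed.

Lemma level_full (R : realType) (K : nat) (p : jsq_state K -> R) :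
  level p (2 * K) = p (full_state K).
Proof.
rewrite /level (bigD1 (full_state K)) //= big1 => [|[i j] ij_ne /=].
  by rewrite addr0 addnn -mul2n eqxx mulr1.
case: eqP => [ijK|]; last by rewrite mulr0.
have := leq_ord i; have := leq_ord j => jK iK.
by case/eqP: ij_ne; congr (_, _); apply: val_inj => /=; lia.
Qed.

(** Zero mean drift of the indicator of $N > n$: only arrivals at level $n$ and departures at level
    $n+1$ change it. *)
Lemma level_cut (R : realType) (K : nat) (rho : R) (p : jsq_state K -> R) (n : nat) :
  invariant_distribution (@jsq_rate R K rho) p -> (n < 2 * K)%N ->
  2 * rho * level p n
  = \sum_x p x * ((0 < x.1)%N + (0 < x.2)%N)%N%:R * (x.1 + x.2 == n.+1 :> nat)%N%:R.
Proof.
move=> p_inv nK; have := jsq_balance _ _ _ _ (fun i j => (n < i + j)%N%:R) p_inv.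
move=> bal; apply/eqP; rewrite -subr_eq0 -[X in _ == X]bal; apply/eqP.
rewrite /level mulr_sumr -sumrB; apply: eq_bigr => -[i j] _ /=.
have := leq_ord i; have := leq_ord j; rewrite /jsq_drift.
move: (nat_of_ord i) (nat_of_ord j) (p _) => {}i {}j c jK iK.
have up (k : nat) : (n < k.+1)%N%:R = (n < k)%N%:R + (k == n)%N%:R :> R.
  by rewrite -natrD; congr _%:R; lia.
have down (k : nat) : (n < k.+1)%N%:R = (n < k)%N%:R + (k.+1 == n.+1)%N%:R :> R.
  by rewrite -natrD; congr _%:R; lia.
(* No arrival at level $n$ is lost: off the diagonal the shorter queue is below $K$, and on it $2i =
   n < 2K$. *)
have arr : (arrival_rate rho i j * (i < K)%N%:R
    + arrival_rate rho j i * (j < K)%N%:R) * (i + j == n)%N%:R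
    = 2 * rho * (i + j == n)%N%:R.
  case: eqP => [ijn|]; last by rewrite !mulr0.
  rewrite !mulr1 /arrival_rate; case: (ltngtP i j) => ij.
  - by rewrite (leq_trans ij jK) mulr1 mul0r addr0.
  - by rewrite (leq_trans ij iK) mulr1 mul0r add0r.
  - subst j; have -> : (i < K)%N by lia.
    by rewrite !mulr1; ring.
have dep1 : (0 < i)%N%:R * ((n < i.-1 + j)%N%:R - (n < i + j)%N%:R)
    = - ((0 < i)%N%:R * (i + j == n.+1)%N%:R) :> R.
  by case: i {iK arr} => [|i]; rewrite ?mul0r ?oppr0 //= addSn down; ring.
have dep2 : (0 < j)%N%:R * ((n < i + j.-1)%N%:R - (n < i + j)%N%:R)
    = - ((0 < j)%N%:R * (i + j == n.+1)%N%:R) :> R.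
  by case: j {jK arr dep1} => [|j]; rewrite ?mul0r ?oppr0 //= addnS down; ring.
rewrite dep1 dep2 addSn addnS !up natrD.
transitivity (c * ((arrival_rate rho i j * (i < K)%N%:R
    + arrival_rate rho j i * (j < K)%N%:R) * (i + j == n)%N%:R
   - ((0 < i)%N%:R + (0 < j)%N%:R) * (i + j == n.+1)%N%:R)).
  by rewrite arr; ring.
by ring.
Qed.

(** At most two servers are busy on the departure side of the cut. *)
Lemma level_ge (R : realType) (K : nat) (rho : R) (p : jsq_state K -> R) (n : nat) :
  invariant_distribution (@jsq_rate R K rho) p -> (n < 2 * K)%N ->
  rho * level p n <= level p n.+1.
Proof.
move=> p_inv nK; rewrite -(@ler_pM2l _ 2) // mulrA (level_cut _ _ _ _ _ p_inv) //.
rewrite /level mulr_sumr; case: p_inv => -[p_ge0 _] _.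
apply: ler_sum => x _; rewrite mulrA [2 * _]mulrC.
apply: ler_wpM2r; first exact: ler0n.
apply: ler_wpM2l; first exact: p_ge0.
by rewrite ler_nat; lia.
Qed.

(** A single customer keeps exactly one server busy, so the cut is sharper here by a factor 2. *)
Lemma level1 (R : realType) (K : nat) (rho : R) (p : jsq_state K -> R) :
  invariant_distribution (@jsq_rate R K rho) p -> (0 < 2 * K)%N ->
  level p 1 = 2 * rho * level p 0.
Proof.
move=> p_inv K0; rewrite (level_cut _ _ _ _ _ p_inv) //.
apply: eq_bigr => x _; case: eqP => [x1|]; last by rewrite !mulr0.
have -> : ((0 < x.1)%N + (0 < x.2)%N)%N = 1%N by lia.
by rewrite !mulr1.
Qed.

(** * Likelihood-ratio order and means *)

(** Monotonicity of [a n / c n], cross-multiplied: consecutive steps chain after multiplying by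
    [c j], which is then cancelled. *)
Lemma cross_ratio_homo (R : realType) (m : nat) (a c : nat -> R) :
  (forall n, 0 < c n) -> (forall n, (n < m)%N -> a n * c n.+1 <= a n.+1 * c n) ->
  forall i j, (i <= j <= m)%N -> a i * c j <= a j * c i.
Proof.
move=> c_gt0 step i; elim=> [|j IH] /andP[ij jm].
  by move: ij; rewrite leqn0 => /eqP ->.
case: (ltngtP i j.+1) ij => // [ij _|-> //].
have {}IH : a i * c j <= a j * c i by apply: IH; lia.
rewrite -(ler_pM2r (c_gt0 j)); apply: (@le_trans _ _ (a j * c i * c j.+1)).
  by rewrite mulrAC ler_pM2r.
by rewrite mulrAC [leRHS]mulrAC ler_pM2r // step.
Qed.

(** Chebyshev's symmetrisation: twice the difference of the two sides is the double sum of
    $(i-j)(a_i c_j - a_j c_i)$, whose terms are all nonnegative. Cross-multiplying by the total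
    masses avoids normalising [a] and [c]. *)
Lemma mean_le_of_cross_ratio (R : realType) (m : nat) (a c : nat -> R) :
  (forall i j, (i <= j <= m)%N -> a i * c j <= a j * c i) ->
  (\sum_(0 <= n < m.+1) c n * n%:R) * (\sum_(0 <= n < m.+1) a n)
  <= (\sum_(0 <= n < m.+1) a n * n%:R) * (\sum_(0 <= n < m.+1) c n).
Proof.
move=> ac; rewrite -subr_ge0 !big_mkord.
set D := _ - _.
have D1 : D = \sum_(i < m.+1) \sum_(j < m.+1) (i%:R - j%:R) * (a i * c j).
  rewrite /D [X in _ - X]mulrC !mulr_suml -sumrB; apply: eq_bigr => i _.
  by rewrite !mulr_sumr -sumrB; apply: eq_bigr => j _; ring.
have D2 : D = \sum_(i < m.+1) \sum_(j < m.+1) (j%:R - i%:R) * (a j * c i).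
  by rewrite D1 exchange_big.
rewrite -(pmulrn_lge0 D (ltn0Sn 1)) mulr2n {1}D1 D2 -big_split /=.
apply: sumr_ge0 => i _; rewrite -big_split /=; apply: sumr_ge0 => j _.
have -> : (i%:R - j%:R) * (a i * c j) + (j%:R - i%:R) * (a j * c i)
  = (i%:R - j%:R) * (a i * c j - a j * c i) by ring.
case: (leqP i j) => [ij|/ltnW ji].
  by apply: mulr_le0; rewrite subr_le0 ?ler_nat // ac // ij -ltnS ltn_ord.
by apply: mulr_ge0; rewrite subr_ge0 ?ler_nat // ac // ji -ltnS ltn_ord.
Qed.

(** * Geometric sums *)

Lemma sum_geometric (R : realType) (m : nat) (rho : R) :
  (1 - rho) * (\sum_(0 <= n < m.+1) rho ^+ n) = 1 - rho ^+ m.+1.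
Proof.
elim: m => [|m IH]; first by rewrite big_nat1; ring.
by rewrite big_nat_recr //= mulrDr IH !exprS; ring.
Qed.

Lemma sum_arith_geometric (R : realType) (m : nat) (rho : R) :
  (1 - rho) ^+ 2 * (\sum_(0 <= n < m.+1) rho ^+ n * n%:R)
  = rho * (1 - (1 + m%:R * (1 - rho)) * rho ^+ m).
Proof.
elim: m => [|m IH]; first by rewrite big_nat1; ring.
by rewrite big_nat_recr //= mulrDr IH !exprS -!natr1; ring.
Qed.

(** * The blocking probability *)

Definition inv_geom {R : realType} (rho : R) (n : nat) : R :=
  \sum_(0 <= i < n) rho ^- i.+1.

Lemma inv_geomS (R : realType) (rho : R) (n : nat) :
  inv_geom rho n.+1 = inv_geom rho n + rho ^- n.+1.
Proof. by rewrite /inv_geom big_nat_recr. Qed.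

Lemma mul_inv_geomS (R : realType) (rho : R) (n : nat) : rho != 0 ->
  rho * inv_geom rho n.+1 = 1 + inv_geom rho n.
Proof.
move=> rho0; elim: n => [|n IH].
  by rewrite inv_geomS /inv_geom big_nil add0r expr1 mulfV // addr0.
rewrite inv_geomS mulrDr IH inv_geomS -addrA; congr (_ + (_ + _)).
by rewrite [in LHS]exprS invfM mulrA mulfV // mul1r.
Qed.

(* For u <= n only: the subtraction is truncated. *)
Definition corner {R : realType} (rho : R) (u n : nat) : R :=
  \sum_(0 <= t < u) 2 ^- t.+1 * (inv_geom rho (n - t) - inv_geom rho t.+1).

(** The increment of [corner] in its last argument. A factor [rho] lowers [n] by one, so these
    increments cancel between arrivals at rate $2\rho$ and two departures. *)
Definition corner_step {R : realType} (rho : R) (u n : nat) : R :=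
  \sum_(0 <= t < u) 2 ^- t.+1 * rho ^- (n - t).

Lemma corner0 (R : realType) (rho : R) (n : nat) : corner rho 0 n = 0.
Proof. by rewrite /corner big_nil. Qed.

Lemma cornerSl (R : realType) (rho : R) (u n : nat) :
  corner rho u.+1 n
  = corner rho u n + 2 ^- u.+1 * (inv_geom rho (n - u) - inv_geom rho u.+1).
Proof. by rewrite /corner big_nat_recr. Qed.

Lemma cornerSr (R : realType) (rho : R) (u n : nat) : (u <= n.+1)%N ->
  corner rho u n.+1 = corner rho u n + corner_step rho u n.+1.
Proof.
move=> un; rewrite /corner -big_split /=; apply: eq_big_nat => t /andP[_ tu].
have tn : (t <= n)%N by lia.
by rewrite subSn // inv_geomS; ring.
Qed.

Lemma mul_corner_step (R : realType) (rho : R) (u n : nat) : rho != 0 ->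
  (u <= n.+1)%N -> rho * corner_step rho u n.+1 = corner_step rho u n.
Proof.
move=> rho0 un; rewrite /corner_step mulr_sumr; apply: eq_big_nat => t /andP[_ tu].
have tn : (t <= n)%N by lia.
by rewrite subSn // [rho ^+ _.+1]exprS invfM mulrCA mulVKf.
Qed.

(* With H = inv_geom rho, the first sum has drift 2 outside (K, K) and the states
   (0, j), j > 0, where it is 2 + H j. Subtracting [corner] repairs this: it
   vanishes for an empty queue, and its drift is -2 corner_step at (K, K), H j
   at (0, j) and 0 elsewhere. *)
Definition poisson_sol {R : realType} (rho : R) (i j : nat) : R :=
  \sum_(0 <= n < (i + j).+1) inv_geom rho n - corner rho (minn i j) (i + j).

(** By symmetry $i \le j$, leaving the diagonal, an empty shorter queue, and $0 < i < j$. At $(K,K)$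
    only departures remain, whence the extra term. *)
Lemma jsq_drift_poisson_sol (R : realType) (K : nat) (rho : R) (i j : nat) :
  rho != 0 -> (i <= K)%N -> (j <= K)%N ->
  jsq_drift K rho (poisson_sol rho) i j
  = 2 - ((i == K) && (j == K))%N%:R
        * (2 * (1 + inv_geom rho (2 * K) - corner_step rho K (2 * K))).
Proof.
move=> rho0.
have symf a b : poisson_sol rho a b = poisson_sol rho b a.
  by rewrite /poisson_sol minnC addnC.
have symd : jsq_drift K rho (poisson_sol rho) i j
    = jsq_drift K rho (poisson_sol rho) j i.
  rewrite /jsq_drift (symf i.+1) (symf i) (symf i.-1) (symf i j.+1) (symf i j.-1).
  by ring.
wlog ij : i j symd / (i <= j)%N => [W iK jK|].
  case: (leqP i j) => [/W|/ltnW /W]; first exact.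
  by rewrite andbC symd; apply.
have QS n : \sum_(0 <= k < n.+2) inv_geom rho k
    = \sum_(0 <= k < n.+1) inv_geom rho k + inv_geom rho n.+1 :> R.
  by rewrite big_nat_recr.
have H0 : inv_geom rho 0 = 0 :> R by rewrite /inv_geom big_nil.
move: ij; rewrite leq_eqVlt => /orP[/eqP <- {j symd} iK _|ij _ jK].
  rewrite andbb /jsq_drift /arrival_rate ltnn eqxx.
  case: i iK => [|i] iK; rewrite /poisson_sol.
    rewrite !minn0 !min0n !corner0 addn0 !subr0 QS big_nat1 H0 !mul0r !addr0 add0r.
    have H1 : rho * inv_geom rho 1 = 1 :> R by rewrite mul_inv_geomS // H0 addr0.
    (* For $K = 0$ the empty state is also the full one. *)
    case: K iK => [|K] _ /=.
      by rewrite /corner_step big_nil H0; ring.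
    by lra.
  have -> : (i.+1 + i.+1 = (i + i).+2)%N by lia.
  have -> : (i.+2 + i.+1 = (i + i).+3)%N by lia.
  have -> : (i.+1 + i.+2 = (i + i).+3)%N by lia.
  have -> : (i + i.+1 = (i + i).+1)%N by lia.
  have -> : (i.+1 + i = (i + i).+1)%N by lia.
  have -> : (minn i.+2 i.+1 = i.+1)%N by lia.
  have -> : (minn i.+1 i.+2 = i.+1)%N by lia.
  have -> : (minn i i.+1 = i)%N by lia.
  have -> : (minn i.+1 i = i)%N by lia.
  rewrite minnn !QS (cornerSr _ _ _ (i + i).+2) ?(cornerSr _ _ _ (i + i).+1); try lia.
  rewrite (cornerSl _ _ i (i + i).+1) /=.
  (* On the diagonal the last term of [corner] is a difference of equal values of $H$, so a
     departure does not see it. *)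
  have -> : ((i + i).+1 - i = i.+1)%N by lia.
  rewrite subrr mulr0 addr0.
  have := mul_inv_geomS _ _ (i + i).+2 rho0.
  have := mul_corner_step _ _ i.+1 (i + i).+2 rho0 ltac:(lia).
  move: iK; rewrite leq_eqVlt => /orP[/eqP <- |iK].
    rewrite ltnn eqxx; have -> : (2 * i.+1 = (i + i).+2)%N by lia.
    by move=> _ _ /=; lra.
  rewrite iK (ltn_eqF iK) /= => PE HE.
  by lra.
case: j ij jK symd => // j; rewrite ltnS => ij jK _.
have -> : (i == K) = false by lia.
rewrite /= mul0r subr0 /jsq_drift /arrival_rate ltnS ij.
have -> : (j.+1 < i)%N = false by lia.
have -> : (j.+1 == i)%N = false by lia.
have -> : (i < K)%N by lia.
rewrite /poisson_sol.
case: i ij => [|i] ij.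
  have -> : minn 1 j.+1 = 1%N by lia.
  rewrite !min0n cornerSl !corner0 !add0n ?add1n /= !QS.
  have := mul_inv_geomS _ _ j.+1 rho0.
  have := mul_inv_geomS _ _ 0 rho0.
  rewrite H0 /= => H1 Hj. rewrite ?subn0; lra.
have -> : (i.+1 + j.+1 = (i + j).+2)%N by lia.
have -> : (i.+2 + j.+1 = (i + j).+3)%N by lia.
have -> : (i + j.+1 = (i + j).+1)%N by lia.
have -> : (i.+1 + j = (i + j).+1)%N by lia.
have -> : (minn i.+2 j.+1 = i.+2)%N by lia.
have -> : (minn i.+1 j.+1 = i.+1)%N by lia.
have -> : (minn i j.+1 = i)%N by lia.
have -> : (minn i.+1 j = i.+1)%N by lia.
rewrite !QS (cornerSl _ _ i.+1) (cornerSr _ _ i.+1 (i + j).+2)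
  ?(cornerSr _ _ i.+1 (i + j).+1); try lia.
rewrite (cornerSl _ _ i (i + j).+1).
have := mul_inv_geomS _ _ (i + j).+2 rho0.
have := mul_corner_step _ _ i.+1 (i + j).+2 rho0 ltac:(lia).
have -> : ((i + j).+1 - i = j.+1)%N by lia.
have -> : ((i + j).+3 - i.+1 = j.+2)%N by lia.
have two : 2 ^- i.+2 = 2 ^- i.+1 / 2 :> R by rewrite exprS invfM mulrC.
(* The halving weights make arrivals at rate $2\rho$ balance the single departure rate of the
   shorter queue; the constants 1 in the recursion of $H$ cancel in the difference. *)
have He : 2 ^- i.+1 * (rho * (inv_geom rho j.+2 - inv_geom rho i.+2))
    = 2 ^- i.+1 * (inv_geom rho j.+1 - inv_geom rho i.+1).
  by rewrite mulrBr !mul_inv_geomS //; congr (_ * _); ring.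
rewrite /= two; move: (2 ^- i.+1) He => e He PE HE; lra.
Qed.

(** The mean drift of [poisson_sol] is $2 - 2\,p(K,K)\,Z = 0$, so $Z$ is the inverse of $p(K,K)$;
    multiplying by $2\rho^{2K}$ clears the negative powers. *)
Lemma blocking_balance (R : realType) (K : nat) (rho : R) (p : jsq_state K -> R) :
  0 < rho -> invariant_distribution (@jsq_rate R K rho) p ->
  p (full_state K) * (2 * (\sum_(0 <= k < (2 * K).+1) rho ^+ k)
                      - \sum_(0 <= k < K) (rho / 2) ^+ k)
  = 2 * rho ^+ (2 * K).
Proof.
move=> rho_gt0 p_inv; have rho0 : rho != 0 by rewrite gt_eqF.
set Z := 1 + inv_geom rho (2 * K) - corner_step rho K (2 * K).
have pZ : p (full_state K) * Z = 1.
  have := jsq_balance _ _ _ _ (poisson_sol rho) p_inv.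
  under eq_bigr do
    rewrite jsq_drift_poisson_sol ?leq_ord // -/Z mulrBr !mulrA.
  case: (p_inv) => -[_ p1] _.
  rewrite sumrB -!mulr_suml p1 (bigD1 (full_state K)) //= !eqxx /= mulr1.
  rewrite big1 => [|[i j] ij_ne /=].
    by lra.
  case: andP => [[/eqP iK /eqP jK]|]; last by rewrite mulr0.
  by case/eqP: ij_ne; congr (_, _); apply: val_inj.
have geom m : rho ^+ m * (1 + inv_geom rho m) = \sum_(0 <= k < m.+1) rho ^+ k.
  elim: m => [|m IH]; first by rewrite /inv_geom big_nil big_nat1 addr0 mulr1.
  rewrite inv_geomS addrA mulrDr mulfV ?expf_neq0 // exprS -mulrA IH.
  rewrite [RHS]big_nat_recl // expr0 mulr_sumr addrC.
  by congr (_ + _); apply: eq_bigr => k _; rewrite exprS.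
(* Termwise, $2\rho^{2K} \cdot 2^{-t-1} \rho^{-(2K-t)} = (\rho/2)^t$. *)
have step : 2 * (rho ^+ (2 * K) * corner_step rho K (2 * K))
    = \sum_(0 <= k < K) (rho / 2) ^+ k.
  rewrite /corner_step !mulr_sumr; apply: eq_big_nat => t /andP[_ tK].
  have -> : (2 * K = t + (2 * K - t))%N by lia.
  rewrite addKn exprD [2 ^+ _]exprS invfM expr_div_n.
  have r1 : rho ^+ (2 * K - t) / rho ^+ (2 * K - t) = 1 by rewrite mulfV ?expf_neq0.
  transitivity (rho ^+ t / 2 ^+ t * (rho ^+ (2 * K - t) / rho ^+ (2 * K - t))).
    by field; rewrite !expf_neq0 ?pnatr_eq0.
  by rewrite r1 mulr1.
rewrite -geom -step -[RHS]mulr1; transitivity (2 * rho ^+ (2 * K) * (p (full_state K) * Z)).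
  by rewrite /Z; ring.
by rewrite pZ.
Qed.

(** * Bounds on the mean in terms of sums *)

Lemma level_le (R : realType) (K : nat) (rho : R) (p : jsq_state K -> R) (n : nat) :
  0 < rho -> invariant_distribution (@jsq_rate R K rho) p -> (n <= 2 * K)%N ->
  level p n * rho ^+ (2 * K) <= p (full_state K) * rho ^+ n.
Proof.
move=> rho_gt0 p_inv nK; rewrite -level_full.
apply: (cross_ratio_homo _ (2 * K) (level p) (fun k => rho ^+ k)).
- by move=> k; apply: exprn_gt0.
- move=> k kK; rewrite exprS mulrA ler_wpM2r ?exprn_ge0 ?(ltW rho_gt0) // mulrC.
  exact: level_ge.
- by rewrite nK leqnn.
Qed.

Lemma mean_customers_level (R : realType) (K : nat) (p : jsq_state K -> R) :
  mean_customers p = \sum_(0 <= n < (2 * K).+1) level p n * n%:R.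
Proof. by rewrite sum_level. Qed.

Lemma mean_customers_upper (R : realType) (K : nat) (rho : R) (p : jsq_state K -> R) :
  0 < rho -> invariant_distribution (@jsq_rate R K rho) p ->
  mean_customers p * rho ^+ (2 * K)
  <= p (full_state K) * \sum_(0 <= n < (2 * K).+1) rho ^+ n * n%:R.
Proof.
move=> rho_gt0 p_inv; rewrite mean_customers_level mulr_suml mulr_sumr !big_mkord.
apply: ler_sum => n _; rewrite mulrAC mulrA ler_wpM2r ?ler0n //.
by apply: level_le; rewrite // -ltnS.
Qed.

Lemma mean_customers_lower (R : realType) (K : nat) (rho : R) (p : jsq_state K -> R) :
  0 < rho -> invariant_distribution (@jsq_rate R K rho) p ->
  2 * (\sum_(0 <= n < (2 * K).+1) rho ^+ n * n%:R)
  <= mean_customers p * (2 * (\sum_(0 <= n < (2 * K).+1) rho ^+ n) - 1).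
Proof.
(* The weight at 0 is 1 instead of 2, to match [level1]; this costs the $-1$ in the total mass and
   nothing in the first moment. *)
move=> rho_gt0 p_inv; pose c n : R := if n is 0%N then 1 else 2 * rho ^+ n.
have rhoX n : 0 < rho ^+ n by apply: exprn_gt0.
have c_gt0 n : 0 < c n by case: n => [|n] //=; rewrite mulr_gt0.
have cE n : c n = 2 * rho ^+ n - (n == 0%N)%:R.
  by case: n => [|n] /=; rewrite ?subr0 // expr0; ring.
have level_sum : \sum_(0 <= n < (2 * K).+1) level p n = 1.
  case: p_inv => -[_ <-] _; under eq_bigr do rewrite -[level _ _]mulr1.
  by rewrite (sum_level _ _ _ (fun=> 1)); under eq_bigr do rewrite mulr1.
have := mean_le_of_cross_ratio _ (2 * K) (level p) c (cross_ratio_homo _ _ _ _ c_gt0 _).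
rewrite level_sum mulr1 -mean_customers_level.
have -> : \sum_(0 <= n < (2 * K).+1) c n * n%:R
    = 2 * \sum_(0 <= n < (2 * K).+1) rho ^+ n * n%:R.
  rewrite mulr_sumr; apply: eq_bigr => -[|n] _; rewrite ?mulr0 //= mulrA //.
have -> : \sum_(0 <= n < (2 * K).+1) c n
    = 2 * (\sum_(0 <= n < (2 * K).+1) rho ^+ n) - 1.
  rewrite big_nat_recl // [in RHS]big_nat_recl //= expr0 mulrDr -mulr_sumr; lra.
(* The ratio condition is an equality at $n = 0$; later the factors 2 cancel and [level_ge]
   suffices. *)
apply=> -[|n] nK /=.
  by rewrite (level1 _ _ _ _ p_inv) // expr1 mulrC mulr1.
have -> : level p n.+1 * (2 * rho ^+ n.+2) = rho * level p n.+1 * (2 * rho ^+ n.+1).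
  by rewrite [rho ^+ n.+2]exprS; ring.
by rewrite ler_pM2r ?mulr_gt0 //; apply: level_ge.
Qed.

(** * Closed forms of the bounds *)

Theorem proposition4 (R : realType) (K : nat) (rho : R) (rho_gt0 : 0 < rho)
    (p : jsq_state K -> R)
    (p_inv : invariant_distribution (@jsq_rate R K rho) p) :
  (rho != 1 ->
    [/\ 2 * rho * (1 - (1 + 2 * K%:R * (1 - rho)) * rho ^+ (2 * K))
          / ((1 - rho) * (1 + rho - 2 * rho ^+ (2 * K + 1)))
          <= mean_customers p,
        mean_customers p
          <= (2 * K%:R * (rho - 1) + rho ^- (2 * K) - 1)
             * (rho * p (full_state K) / (rho - 1) ^+ 2)
      & p (full_state K)
          = 2 * rho ^+ (2 * K)
            / (2 * (\sum_(0 <= k < (2 * K).+1) rho ^+ k)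
               - \sum_(0 <= k < K) (rho / 2) ^+ k)])
  /\
  (rho = 1 ->
    K%:R * (2 * K%:R + 1) / (2 * K%:R + 1 / 2) <= mean_customers p
    /\ mean_customers p <= K%:R * (2 * K%:R + 1) / (2 * K%:R + 2 ^- K)).
Proof.
have block := blocking_balance _ _ _ _ rho_gt0 p_inv.
have lower := mean_customers_lower _ _ _ _ rho_gt0 p_inv.
have upper := mean_customers_upper _ _ _ _ rho_gt0 p_inv.
have rhoX n : 0 < rho ^+ n by apply: exprn_gt0.
have sum_gt0 : 0 < 2 * (\sum_(0 <= n < (2 * K).+1) rho ^+ n) - 1.
  rewrite big_nat_recl // expr0.
  have : 0 <= \sum_(0 <= n < 2 * K) rho ^+ n.+1 by apply: sumr_ge0 => n _; apply: ltW.
  by lra.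
split=> [rho1|rho1].
  have r1 : 1 - rho != 0 by rewrite subr_eq0 eq_sym.
  have geo := sum_geometric _ (2 * K) rho.
  have ageo := sum_arith_geometric _ (2 * K) rho.
  split.
  - move: lower; rewrite -ler_pdivrMr //; congr (_ <= _).
    move: geo ageo sum_gt0; rewrite addn1.
    set S := \sum_(0 <= n < _) _; set A := \sum_(0 <= n < _) _.
    move=> geo ageo sum_gt0.
    (* Numerator and denominator are [2 * A] and [2 * S - 1], both scaled by $(1-\rho)^2$. *)
    have -> : 1 + rho - 2 * rho ^+ (2 * K).+1 = (1 - rho) * (2 * S - 1).
      by rewrite mulrBr mulrCA geo; ring.
    have -> : 2 * rho * (1 - (1 + 2 * K%:R * (1 - rho)) * rho ^+ (2 * K))
        = (1 - rho) ^+ 2 * (2 * A).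
      by rewrite mulrCA ageo natrM mulrA.
    by field; rewrite r1 gt_eqF.
  - rewrite -(ler_pM2r (rhoX (2 * K)%N)); apply: (le_trans upper).
    have r1' : rho - 1 != 0 by rewrite subr_eq0.
    (* The closed form is exactly the bound just used, so an identity remains. *)
    rewrite le_eqVlt; apply/orP; left; apply/eqP.
    apply: (mulfI (expf_neq0 2 r1)); rewrite mulrCA ageo natrM.
    by field; rewrite r1' gt_eqF.
  (* The denominator is nonzero because its product with $p(K,K)$ is $2\rho^{2K} > 0$. *)
  - rewrite -block mulfK //; apply: contraTneq (rhoX (2 * K)%N) => d0.
    by move: block; rewrite d0 mulr0; lra.
rewrite {rho rho_gt0 p_inv rhoX sum_gt0}rho1 in block lower upper *.
have sum1 m : \sum_(0 <= n < m) (1 : R) ^+ n = m%:R.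
  by under eq_bigr do rewrite expr1n; rewrite sumr_const_nat subn0.
have sumid m : 2 * \sum_(0 <= n < m.+1) (1 : R) ^+ n * n%:R = m%:R * (m%:R + 1).
  elim: m => [|m IH]; first by rewrite big_nat1 mulr0 mul0r mulr0.
  by rewrite big_nat_recr //= mulrDr IH expr1n -natr1; ring.
have sum_half m : \sum_(0 <= k < m) (1 / 2 : R) ^+ k = 2 - 2 * 2 ^- m.
  elim: m => [|m IH]; first by rewrite big_nil expr0 invr1; ring.
  rewrite big_nat_recr //= IH expr_div_n expr1n exprS invfM.
  by rewrite [2 * (_ * _)]mulrA mulfV ?pnatr_eq0 //; lra.
have den : 0 < 2 * K%:R + 2 ^- K :> R.
  by rewrite ltr_wpDl ?mulr_ge0 ?ler0n // invr_gt0 exprn_gt0.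
have K0 : 0 <= K%:R :> R by exact: ler0n.
move: block lower upper; rewrite sumid sum1 sum_half !expr1n -[(2 * K).+1%:R]natr1 natrM.
move=> block lower upper; split.
  by rewrite ler_pdivrMr; lra.
(* At $\rho = 1$ the bracket in [block] is $2(2K+1) - (2 - 2 \cdot 2^{-K})$, twice this
   denominator. *)
have full : p (full_state K) * (2 * K%:R + 2 ^- K) = 1 by lra.
rewrite ler_pdivlMr //; rewrite mulr1 in upper.
apply: (le_trans (ler_wpM2r (ltW den) upper)).
rewrite mulrAC full mul1r -(@ler_pM2l _ 2) // sumid natrM.
by lra.
Qed.
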